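(* Let $n>2$ and let $(G,f)=\mathrm{der}_{\theta,b}(G,\cdot)$ be an $n$-ary (polyadic) group, where $(G,\cdot)$ is a group, $\theta$ is an automorphism of $(G,\cdot)$ and $b\in G$. Let $(G^{\ast},\circ)$ be the Post's cover of $(G,f)$. Then the following are equivalent: (i) the polyadic group $(G,f)$ is equational noetherian; (ii) the group $(G^{\ast},\circ)$ is equational noetherian; (iii) the group $(G,\cdot)$ is equational noetherian.
   Context: Notation: $x_i^j$ denotes the sequence $x_i,x_{i+1},\ldots,x_j$, and $\stackrel{(t)}{x}$ denotes $x,\ldots,x$ ($t$ times). Polyadic groups. An $n$-ary group (polyadic group) is a non-empty set $G$ with an operation $f:G^n\to G$ such that $f(x_1^{i-1},f(x_i^{n+i-1}),x_{n+i}^{2n-1})=f(x_1^{j-1},f(x_j^{n+j-1}),x_{n+j}^{2n-1})$ for all $1\le i<j\le n$ and all $x_1,\ldots,x_{2n-1}\in G$, and such that for all $a_1,\ldots,a_n,c\in G$ and $1\le i\le n$ there is a unique $x\in G$ with $f(a_1^{i-1},x,a_{i+1}^n)=c$. The skew element $\overline{x}$ of $x$ is the unique $y$ with $f(\stackrel{(n-1)}{x},y)=x$. Polyadic groups form a variety in the language $(f,{}^-)$. Writing $(G,f)=\mathrm{der}_{\theta,b}(G,\cdot)$ means: $(G,\cdot)$ is a group, $\theta$ an automorphism of it and $b\in G$ with $\theta(b)=b$, $\theta^{n-1}(x)=bxb^{-1}$ for all $x\in G$, and $f(x_1,\ldots,x_n)=x_1\theta(x_2)\theta^2(x_3)\cdots\theta^{n-1}(x_n)b$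 for all $x_1,\ldots,x_n\in G$. (Every $n$-ary group has this form.) Retract. For $a\in G$, the retract $ret_a(G,f)$ is the group on $G$ with operation $x\ast y=f(x,\stackrel{(n-2)}{a},y)$; all retracts of $(G,f)$ are isomorphic. Post's cover. The Post's cover of $(G,f)$ is the unique group $(G^{\ast},\circ)$ such that: $G$ is contained in $G^{\ast}$ as a coset of a normal subgroup $R$; $R$ is isomorphic to a retract of $(G,f)$; $G^{\ast}/R\cong\mathbb{Z}_{n-1}$; $f(x_1,\ldots,x_n)=x_1\circ\cdots\circ x_n$ for all $x_1,\ldots,x_n\in G$; and $G^{\ast}$ is generated by $G$. Equational noetherian. A polyadic equation with coefficients from $G$ in variables $x_1,\ldots,x_m$ is an expression $p(x_1,\ldots,x_m)\approx q(x_1,\ldots,x_m)$ where $p,q$ are terms built from the variables and elements of $G$ (as constants) using $f$ and $^-$. A system is a set $S$ of such equations (in a finite set of variables $x_1,\ldots,x_m$), and $V_G(S)\subseteq G^m$ is its solution set in $G$. $(G,f)$ is equational noetherian if for every system $S$ there is a finite subsystem $S_0\subseteq S$ with $V_G(S)=V_G(S_0)$. A group is called equational noetherian if the same holds for systems of group equations in finitely many variables with coefficients from the group (terms built from product, inverse, variables and elements of that group as constants). *)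

(* Defs.v *)
From HB Require Import structures.
From mathcomp Require Import all_boot all_order all_algebra.
From mathcomp Require Import boolp classical_sets functions cardinality.

Set Implicit Arguments.
Unset Strict Implicit.
Unset Printing Implicit Defensive.

Local Open Scope classical_set_scope.
Local Open Scope group_scope.

Section Polyadic.
Context {n : nat} {T : choiceType}.
Implicit Type f : n.-tuple T -> T.

(* With x = x_0, x_1, ... (only the first 2n - 1 entries are used), this is
   f(x_0, .., x_(i-1), f(x_i, .., x_(i+n-1)), x_(i+n), .., x_(2n-2)). *)
Definition nested f (x : nat -> T) (i : 'I_n) : T :=
  f [tuple if (k < i)%N then x k
           else if k == i then f [tuple x (i + l)%N | l < n]
           else x (k + n.-1)%N | k < n].

Definition is_polyadic_group f : Prop :=
  [/\ inhabited T,
      forall (x : nat -> T) (i j : 'I_n), (i < j)%N ->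
        nested f x i = nested f x j
    & forall (a : n.-tuple T) (c : T) (i : 'I_n),
        exists! x : T, f [tuple if k == i then x else tnth a k | k < n] = c].

(* The unique y with f(x, .., x, y) = x; when there is no such y (which cannot
   happen in a polyadic group) the value is x. *)
Definition skew f (x : T) : T :=
  xget x [set y | f [tuple if (k < n.-1)%N then x else y | k < n] = x].

Definition retract f (a x y : T) : T :=
  f [tuple if k == 0 :> nat then x
           else if k == n.-1 :> nat then y else a | k < n].

End Polyadic.

(* (G, f) = der_{theta, b} G *)
Definition is_der (n : nat) (G : groupType) (f : n.-tuple G -> G)
    (theta : {multiplicative G -> G}) (b : G) : Prop :=
  [/\ bijective theta,
      theta b = b,
      forall x : G, iter n.-1 theta x = b * x * b^-1
    & forall x : n.-tuple G,
        f x = (\prod_(i < n) iter i theta (tnth x i)) * b].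

Definition is_subgroup (G : groupType) (H : set G) : Prop :=
  group_closed (mem H).

Definition is_normal_subgroup (G : groupType) (H : set G) : Prop :=
  is_subgroup H /\ forall x g : G, H x -> H (x ^ g).

Definition left_coset (G : groupType) (H : set G) (g : G) : set G :=
  [set g * h | h in H].

Definition generated (G : groupType) (A : set G) : set G :=
  smallest (@is_subgroup G) A.

(* R is isomorphic to the retract ret_a(T, f). *)
Definition isog_retract (n : nat) (T : choiceType) (f : n.-tuple T -> T)
    (a : T) (G : groupType) (R : set G) : Prop :=
  exists h : T -> G,
    set_bij setT R h /\ forall x y, h (retract f a x y) = h x * h y.

(* The elements of G / R are the cosets of R, multiplied as sets. To be used
   with k > 1 only, since 'Z_k is Z/2Z for k = 0, 1. *)
Definition quotient_isog_Z (G : groupType) (R : set G) (k : nat) : Prop :=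
  exists psi : 'Z_k -> set G,
    set_bij setT (range (left_coset R)) psi /\
    forall i j : 'Z_k,
      psi (i + j)%R = [set u * v | u in psi i & v in psi j].

(* iota is the inclusion of T in its Post's cover. *)
Definition is_post_cover (n : nat) (T : choiceType) (f : n.-tuple T -> T)
    (Gs : groupType) (iota : T -> Gs) : Prop :=
  [/\ injective iota,
      exists R : set Gs,
        [/\ is_normal_subgroup R,
            exists g : Gs, range iota = left_coset R g,
            exists a : T, isog_retract f a R
          & quotient_isog_Z R n.-1],
      forall x : n.-tuple T, iota (f x) = \prod_(i < n) iota (tnth x i)
    & generated (range iota) = setT].

Section EquationalNoetherian.
Context {T : Type} (term : nat -> Type)
  (eval : forall m, m.-tuple T -> term m -> T).

Definition equation (m : nat) : Type := (term m * term m)%type.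

Definition solutions (m : nat) (S : set (equation m)) : set (m.-tuple T) :=
  [set v | forall e, S e -> eval v e.1 = eval v e.2].

Definition equational_noetherian : Prop :=
  forall (m : nat) (S : set (equation m)),
    exists S0 : set (equation m),
      [/\ S0 `<=` S, finite_set S0 & solutions S = solutions S0].

End EquationalNoetherian.

Inductive polyadic_term (n : nat) (T : Type) (m : nat) : Type :=
| PVar of 'I_m
| PConst of T
| POp of ('I_n -> polyadic_term n T m)
| PSkew of polyadic_term n T m.

Fixpoint polyadic_eval (n : nat) (T : choiceType) (f : n.-tuple T -> T)
    (m : nat) (v : m.-tuple T) (t : polyadic_term n T m) : T :=
  match t with
  | PVar i => tnth v i
  | PConst c => c
  | POp ts => f [tuple polyadic_eval f v (ts i) | i < n]
  | PSkew t1 => skew f (polyadic_eval f v t1)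
  end.

Definition polyadic_equational_noetherian (n : nat) (T : choiceType)
    (f : n.-tuple T -> T) : Prop :=
  equational_noetherian (@polyadic_eval n T f).

Inductive group_term (T : Type) (m : nat) : Type :=
| GVar of 'I_m
| GConst of T
| GMul of group_term T m & group_term T m
| GInv of group_term T m.

Fixpoint group_eval (G : groupType) (m : nat) (v : m.-tuple G)
    (t : group_term G m) : G :=
  match t with
  | GVar i => tnth v i
  | GConst c => c
  | GMul t1 t2 => group_eval v t1 * group_eval v t2
  | GInv t1 => (group_eval v t1)^-1
  end.

Definition group_equational_noetherian (G : groupType) : Prop :=
  equational_noetherian (@group_eval G).

(* Main.v *)
Require Import Defs.
From mathcomp Require Import all_boot.
From mathcomp Require Import boolp classical_sets functions cardinality.

(** Being equational noetherian is a property of the family of subsets of the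
    powers [T^m] that single equations cut out: every intersection of members
    of the family is a finite one. Hence it can be transferred from [T'] to [T]
    when [T^m] is covered by finitely many pieces, on each of which an equation
    over [T] is either unsolvable or equivalent to an equation over [T']
    ([noetherian_transfer]). All implications are instances of this principle;
    they are (i) => (iii) => (ii) => (i) and (ii) => (iii).

    - (i) => (iii): the product of [G] is a polyadic term with constants,
      [x * y = f (x, b^-1, 1, .., 1, y)], where [n > 2] leaves room for [b^-1]
      ([der_mul]). Inverses are dealt with by doubling the variables: a group
      term in the [x_i] is a product of constants, of [x_i] and of [x_i^-1].

    - (ii) => (i): in the cover, [f] is an iterated product and the skew element
      of [x] is [x^(2-n)], so that polyadic terms over [G] become group terms
      over the cover ([polyadic_noetherian_of_group]).

    - A retract of [(G, f)] is [G] with the product [x * u * y] for some [u]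
      ([der_retract]), hence a copy of the group [G]. The subgroup [R] of the
      cover is therefore the image of an injective morphism from [G], which
      gives (ii) => (iii).

    - (iii) => (ii): [R] is normal of finite index. Once the cosets of the
      variables are prescribed, the value of a term over the cover is [g * r],
      where [g] is independent of the variables and [r] is the value in [R] of
      a term over [G] in the conjugates of the [R]-components of the variables
      by coset representatives. An equation [g * r = g' * r'] is then unsolvable
      or an equation over [G] ([noetherian_finite_extension]). *)

Set Implicit Arguments.
Unset Strict Implicit.
Unset Printing Implicit Defensive.

Local Open Scope classical_set_scope.
Local Open Scope group_scope.

(** * Transfer of noetherianity between languages *)

(** A finite set of translated equations comes from finitely many of the
    original ones. The choice of an antecedent is made through [option A]
    because [A] may be empty. *)
Lemma finite_subset_lift (A B : Type) (r : A -> B -> Prop) (S : set A)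
    (S' : set B) :
  finite_set S' -> (forall e', S' e' -> exists2 e, S e & r e e') ->
  exists S0 : set A, [/\ S0 `<=` S, finite_set S0 &
    forall e', S' e' -> exists2 e, S0 e & r e e'].
Proof.
move=> finS' liftS'.
have /choice[s sP] : forall e', exists oe : option A,
    S' e' -> exists2 e, oe = Some e & S e /\ r e e'.
  move=> e'; have [/liftS'[e Se ree']|nS'e'] := pselect (S' e').
    by exists (Some e) => _; exists e.
  by exists None.
exists [set e | S e /\ (s @` S') (Some e)]; split => [e []//||e' S'e'].
- have finI : finite_set (s @` S') by exact: finite_image.
  apply: (sub_finite_set _ (bigcup_finite (D := s @` S')
    (F := fun oe => [set e | oe = Some e]) finI _)) => [e [_ se]|[e|] _].
  + by exists (Some e).
  + by rewrite (_ : [set _ | _] = [set e]) //; apply/seteqP; split => ? /=;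
      [case|move=> ->].
  + by rewrite (_ : [set _ | _] = set0) //; apply/seteqP; split.
- have [e se [Se ree']] := sP e' S'e'.
  by exists e => //; split => //; exists e'.
Qed.

Section Transfer.
Context {T : Type} {term : nat -> Type}
  (eval : forall m, m.-tuple T -> term m -> T).
Context {T' : Type} {term' : nat -> Type}
  (eval' : forall m, m.-tuple T' -> term' m -> T').

(** The pieces are the images of the [alpha i]. Each of them needs finitely many
    equations of the system: one of them if it is unsolvable there, and otherwise
    antecedents of a finite subsystem of the translated system. Unsolvable
    equations are a case apart since [T'] may be trivial, and then every equation
    over it has a solution. *)
Lemma noetherian_transfer :
  (forall m, exists (I : finType) (X : Type) (m' : nat)
      (alpha : I -> X -> m.-tuple T) (beta : X -> m'.-tuple T'),
    (forall v, exists i x, v = alpha i x) /\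
    forall i (e : equation term m),
      (exists e' : equation term' m', forall x,
         eval (alpha i x) e.1 = eval (alpha i x) e.2 <->
         eval' (beta x) e'.1 = eval' (beta x) e'.2) \/
      (forall x, eval (alpha i x) e.1 <> eval (alpha i x) e.2)) ->
  equational_noetherian eval' -> equational_noetherian eval.
Proof.
move=> /[swap] noeth' + m S => /(_ m)[I [X [m' [alpha [beta [cover tr]]]]]].
have piece i : exists S0 : set (equation term m), [/\ S0 `<=` S, finite_set S0 &
    forall x, solutions eval S0 (alpha i x) -> solutions eval S (alpha i x)].
  have [[e Se unsol]|solvable] := pselect (exists2 e, S e &
      forall x, eval (alpha i x) e.1 <> eval (alpha i x) e.2).
    exists [set e]; split => [_ ->//||x /(_ e erefl)/unsol//].
    exact: finite_set1.
  pose r (e : equation term m) (e' : equation term' m') := forall x,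
    eval (alpha i x) e.1 = eval (alpha i x) e.2 <->
    eval' (beta x) e'.1 = eval' (beta x) e'.2.
  have [S'0 [sS'0 finS'0 solS'0]] :=
    noeth' m' [set e' | exists2 e, S e & r e e'].
  have [S0 [sS0 finS0 S0P]] := finite_subset_lift finS'0 sS'0.
  exists S0; split => // x solS0 e Se.
  have [[e' ee']|unsol] := tr i e; last by case: solvable; exists e.
  apply/ee'; have : solutions eval' S'0 (beta x).
    by move=> e1' /S0P[e1 /solS0 he1 /(_ x) <-].
  by rewrite -solS'0; apply; exists e.
have [S0 S0P] := choice piece.
exists (\bigcup_(i in [set: I]) S0 i); split.
- by move=> e [i _]; have [/(_ e)] := S0P i.
- by apply: bigcup_finite => // i _; have [] := S0P i.
- apply/seteqP; split => v solv.
    by move=> e [i _ S0ie]; apply: solv; have [/(_ e S0ie)] := S0P i.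
  have [i [x vE]] := cover v; rewrite vE in solv *.
  have [_ _] := S0P i; apply => e S0ie.
  by apply: solv; exists i.
Qed.

(** The functions obtained by evaluating a term at the tuples [beta x]; working
    with them instead of terms avoids an explicit translation of syntax. *)
Definition definable (X : Type) (m : nat) (beta : X -> m.-tuple T')
    (F : X -> T') : Prop :=
  exists t : term' m, forall x, F x = eval' (beta x) t.

Lemma noetherian_pullback (phi : T -> T') :
  injective phi ->
  (forall m, exists m' (beta : m.-tuple T -> m'.-tuple T'),
     forall t : term m, definable beta (fun v => phi (eval v t))) ->
  equational_noetherian eval' -> equational_noetherian eval.
Proof.
move=> phi_inj def; apply: noetherian_transfer => m.
have [m' [beta defm]] := def m.
exists unit, (m.-tuple T), m', (fun _ v => v), beta; split.
  by move=> v; exists tt, v.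
move=> _ [t1 t2]; left; have [[t1' e1] [t2' e2]] := (defm t1, defm t2).
exists (t1', t2') => v /=; rewrite -e1 -e2.
by split => [->|/phi_inj].
Qed.

End Transfer.

(** * Functions defined by group terms *)

Section GroupDefinable.
Context {G : groupType} {X : Type} {m : nat} (beta : X -> m.-tuple G).
Local Notation gdef := (definable (@group_eval G) beta).

Lemma gdef_var i : gdef (fun x => tnth (beta x) i).
Proof. by exists (GVar _ i). Qed.

Lemma gdef_const c : gdef (fun=> c).
Proof. by exists (GConst _ c). Qed.

Lemma gdef_mul F1 F2 : gdef F1 -> gdef F2 -> gdef (fun x => F1 x * F2 x).
Proof.
by move=> [t1 e1] [t2 e2]; exists (GMul t1 t2) => x /=; rewrite e1 e2.
Qed.

Lemma gdef_inv F : gdef F -> gdef (fun x => (F x)^-1).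
Proof. by move=> [t e]; exists (GInv t) => x /=; rewrite e. Qed.

Lemma gdef_conj F c : gdef F -> gdef (fun x => F x ^ c).
Proof.
move=> Fdef; apply: gdef_mul (gdef_const c^-1) _.
exact: gdef_mul Fdef (gdef_const c).
Qed.

Lemma gdef_prod k (F : 'I_k -> X -> G) :
  (forall i, gdef (F i)) -> gdef (fun x => \prod_(i < k) F i x).
Proof.
elim: k F => [|k IHk] F Fdef.
  have -> : (fun x => \prod_(i < 0) F i x) = fun=> 1.
    by apply/funext => x; rewrite big_ord0.
  exact: gdef_const.
have -> : (fun x => \prod_(i < k.+1) F i x) =
    fun x => F ord0 x * \prod_(i < k) F (lift ord0 i) x.
  by apply/funext => x; rewrite big_ord_recl.
by apply: gdef_mul => //; apply: IHk.
Qed.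

End GroupDefinable.

(** * Subgroups and extensions of finite index *)

Section GroupExtension.
Context {G H : groupType} (phi : G -> H).
Hypothesis phiM : {morph phi : x y / x * y}.

Lemma mulg_morph1 : phi 1 = 1.
Proof. by apply: (mulgI (phi 1)); rewrite -phiM !mulg1. Qed.

Lemma mulg_morphV : {morph phi : x / x^-1}.
Proof.
by move=> x; apply: (mulgI (phi x)); rewrite -phiM !mulgV mulg_morph1.
Qed.

Hypothesis phi_inj : injective phi.

Lemma noetherian_subgroup :
  group_equational_noetherian H -> group_equational_noetherian G.
Proof.
apply: (noetherian_pullback phi_inj) => m.
exists m, (map_tuple phi) => t.
elim: t => [i|c|t1 IH1 t2 IH2|t IH] /=.
- by exists (GVar _ i) => v; rewrite /= tnth_map.
- exact: gdef_const.
- rewrite (_ : (fun _ => _) = fun v => phi (group_eval v t1) *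
    phi (group_eval v t2)); first exact: gdef_mul.
  by apply/funext => v; rewrite phiM.
- rewrite (_ : (fun _ => _) = fun v => (phi (group_eval v t))^-1).
    exact: gdef_inv.
  by apply/funext => v; rewrite mulg_morphV.
Qed.

Context {J : finType} (c : J -> H).
Hypothesis phi_normal : forall x h, exists y, phi x ^ h = phi y.
Hypothesis c_cover : forall h, exists j x, h = c j * phi x.

(** Words in elements [c j * phi y] are normalized by moving the letters of [H] to
    the left, which conjugates those of the subgroup. The conjugate of [phi y] by
    any [h = c j * phi x] is that by [c j], conjugated by the constant [phi x];
    so the finitely many conjugates by the [c j], taken as variables over [G],
    suffice, and are permuted by further conjugation up to constants. *)
Lemma noetherian_finite_extension :
  group_equational_noetherian G -> group_equational_noetherian H.
Proof.
apply: noetherian_transfer => m.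
have /choice[conj conjP] : forall p : G * J, exists y, phi p.1 ^ c p.2 = phi y.
  by move=> [x j]; apply: phi_normal.
(* The variables over [G] are indexed by the pairs of a variable over [H] and a
   coset representative. *)
pose beta (y : m.-tuple G) : #|{: 'I_m * J}|.-tuple G :=
  [tuple conj (tnth y (enum_val k).1, (enum_val k).2) | k < #|{: 'I_m * J}|].
(* The functions with values in the subgroup that are given by a term over [G];
   they are closed under conjugation by [H] ([rep_conj] below). *)
pose rep (F : m.-tuple G -> H) := exists u,
  definable (@group_eval G) beta u /\ forall y, F y = phi (u y).
have rep_ext F F' : (forall y, F' y = F y) -> rep F -> rep F'.
  by move=> FF' [u [udef uE]]; exists u; split => // y; rewrite FF' uE.
have rep_const x : rep (fun=> phi x).
  by exists (fun=> x); split => //; apply: gdef_const.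
have rep_mul F F' : rep F -> rep F' -> rep (fun y => F y * F' y).
  move=> [u [udef uE]] [u' [u'def u'E]]; exists (fun y => u y * u' y).
  by split => [|y]; [exact: gdef_mul | rewrite phiM uE u'E].
have rep_inv F : rep F -> rep (fun y => (F y)^-1).
  move=> [u [udef uE]]; exists (fun y => (u y)^-1).
  by split => [|y]; [exact: gdef_inv | rewrite mulg_morphV uE].
have rep_var i h : rep (fun y => phi (tnth y i) ^ h).
  have [j [x ->]] := c_cover h.
  exists (fun y => conj (tnth y i, j) ^ x); split; last first.
    move=> y; rewrite conjgM (conjP (_, _)) /conjg !phiM.
    by rewrite mulg_morphV.
  apply: gdef_conj; exists (GVar _ (enum_rank (i, j))) => y.
  by rewrite /= tnth_mktuple enum_rankK.
have rep_conj F h : rep F -> rep (fun y => F y ^ h).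
  move=> [u [[t uE] FE]].
  apply: (rep_ext (fun y => phi (group_eval (beta y) t) ^ h)).
    by move=> y; rewrite FE uE.
  elim: t {u F uE FE} => [k|x|t1 IH1 t2 IH2|t IH] /=.
  - apply: (rep_ext _ _ _ (rep_var (enum_val k).1 (c (enum_val k).2 * h))) => y.
    by rewrite tnth_mktuple -conjP /= conjgM.
  - by have [y ->] := phi_normal x h; apply: rep_const.
  - by apply: (rep_ext _ _ _ (rep_mul _ _ IH1 IH2)) => y; rewrite phiM conjMg.
  - by apply: (rep_ext _ _ _ (rep_inv _ IH)) => y; rewrite mulg_morphV conjVg.
exists {ffun 'I_m -> J}, (m.-tuple G), #|{: 'I_m * J}|.
pose alpha (s : {ffun 'I_m -> J}) (y : m.-tuple G) :=
  [tuple c (s i) * phi (tnth y i) | i < m].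
exists alpha, beta; split.
  move=> v; have /fin_all_exists[p pP] : forall i : 'I_m, exists p : J * G,
      tnth v i = c p.1 * phi p.2.
    by move=> i; have [j [x ->]] := c_cover (tnth v i); exists (j, x).
  exists [ffun i => (p i).1], [tuple (p i).2 | i < m].
  by apply: eq_from_tnth => i; rewrite !tnth_mktuple ffunE pP.
move=> s.
have coset (t : group_term H m) : exists g F, rep F /\ forall y,
    group_eval (alpha s y) t = g * F y.
  elim: t => [i|g|t1 [g1 [F1 [F1rep F1E]]] t2 [g2 [F2 [F2rep F2E]]]|
    t [g [F [Frep FE]]]] /=.
  (* [phi (tnth y i)] itself need not be a variable: [1] need not be a coset
     representative. Conjugation by [1] makes [rep_var] apply. *)
  - exists (c (s i)), (fun y => phi (tnth y i) ^ 1); split => // y.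
    by rewrite tnth_mktuple conjg1.
  - exists g, (fun=> phi 1); split => // y.
    by rewrite mulg_morph1 mulg1.
  - exists (g1 * g2), (fun y => F1 y ^ g2 * F2 y); split.
      exact/rep_mul/F2rep/rep_conj.
    by move=> y; rewrite F1E F2E /conjg !mulgA mulgK.
  - exists g^-1, (fun y => (F y)^-1 ^ g^-1); split.
      exact/rep_conj/rep_inv.
    by move=> y; rewrite FE /conjg invgK invgM !mulgA mulVg mul1g.
move=> [t1 t2] /=.
have [g1 [F1 [[u1 [[t1' u1E] F1E]] t1E]]] := coset t1.
have [g2 [F2 [[u2 [[t2' u2E] F2E]] t2E]]] := coset t2.
have [[r rE]|nr] := pselect (exists r, g1^-1 * g2 = phi r).
  left; exists (t1', GMul (GConst _ r) t2') => y /=.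
  rewrite t1E t2E F1E F2E -u1E -u2E.
  have -> : g2 = g1 * phi r by rewrite -rE mulgA mulgV mul1g.
  rewrite -mulgA -phiM; split => [/mulgI/phi_inj//|-> //].
right => y; rewrite t1E t2E F1E F2E => e; apply: nr.
exists (u1 y * (u2 y)^-1); rewrite phiM mulg_morphV.
apply: (mulgI g1); apply: (mulIg (phi (u2 y))).
by rewrite !mulgA mulgV mul1g mulgVK.
Qed.

End GroupExtension.

(** * Polyadic groups inside groups *)

Section PolyadicInGroup.
Context {n : nat} {T : choiceType} (f : n.-tuple T -> T).
Context {H : groupType} (iota : T -> H).
Hypothesis n_gt1 : (1 < n)%N.
Hypothesis hf : is_polyadic_group f.
Hypothesis iota_inj : injective iota.
Hypothesis iotaM : forall x, iota (f x) = \prod_(i < n) iota (tnth x i).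

(** The equation [f (x, .., x, y) = x] defining the skew element [y] reads
    [x^(n-1) * y = x] in [H]. *)
Lemma iota_skew x :
  iota (skew f x) = (\prod_(i < n.-1) iota x)^-1 * iota x.
Proof.
have : f [tuple if (k < n.-1)%N then x else skew f x | k < n] = x.
  apply: (@xgetPex _ x
    [set y | f [tuple if (k < n.-1)%N then x else y | k < n] = x]).
  (* Solvability of [f] in its last argument makes the set above nonempty, so
     that [skew] does not take its default value. *)
  have n1_lt_n : (n.-1 < n)%N by rewrite prednK // ltnW.
  have [_ _ /(_ [tuple x | k < n] x (Ordinal n1_lt_n))[y [fy _]]] := hf.
  exists y; rewrite /= -[RHS]fy; congr f; apply: eq_from_tnth => k.
  rewrite !tnth_mktuple -val_eqE /=.
  have : (k <= n.-1)%N by rewrite -ltnS prednK // ltnW.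
  by rewrite leq_eqVlt; case: eqP => [->|_] /=; [rewrite ltnn | move->].
move/(congr1 iota); rewrite iotaM.
move: (skew f x) => y; clear -n_gt1.
case: n n_gt1 => // n' _.
rewrite big_ord_recr /= tnth_mktuple /= ltnn => e.
rewrite -[X in _ * X]e mulgA; under [X in _ * X * _]eq_bigr => i _.
  by rewrite tnth_mktuple /= ltn_ord; over.
by rewrite mulVg mul1g.
Qed.

Lemma polyadic_noetherian_of_group :
  group_equational_noetherian H -> polyadic_equational_noetherian f.
Proof.
apply: (noetherian_pullback iota_inj) => m.
exists m, (map_tuple iota) => t.
elim: t => [i|c|ts IH|t IH] /=.
- by exists (GVar _ i) => v; rewrite /= tnth_map.
- exact: gdef_const.
- rewrite (_ : (fun _ => _) = fun v => \prod_(i < n)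
    iota (polyadic_eval f v (ts i))); first exact: gdef_prod.
  apply/funext => v; rewrite iotaM.
  by apply: eq_bigr => i _; rewrite tnth_mktuple.
- rewrite (_ : (fun _ => _) = fun v => (\prod_(i < n.-1)
    iota (polyadic_eval f v t))^-1 * iota (polyadic_eval f v t)).
    by apply: gdef_mul => //; apply: gdef_inv; apply: gdef_prod.
  by apply/funext => v; rewrite iota_skew.
Qed.

End PolyadicInGroup.

(** * The group from which a polyadic group is derived *)

Section Derived.
Context {n : nat} {G : groupType} (f : n.-tuple G -> G).
Context (theta : {multiplicative G -> G}) (b : G).
Hypothesis n_gt2 : (2 < n)%N.
Hypothesis hder : is_der f theta b.

Let thetaM : {morph theta : x y / x * y} := gmulfM.

(** The last factor [theta^(n-1) y] is [b * y * b^-1], whose [b^-1] cancels the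
    final [b] of [f]; the remaining [b] is cancelled by the second argument, as
    [theta] fixes [b^-1]. *)
Lemma der_mul x y :
  f [tuple if k == 0 :> nat then x else if k == n.-1 :> nat then y
           else if k == 1%N :> nat then b^-1 else 1 | k < n] = x * y.
Proof.
have [_ thetab thetan ->] := hder; move: thetan.
case: n n_gt2 => [|[|[|k]]] // _ thetak.
rewrite 2!big_ord_recl big_ord_recr /= !tnth_mktuple /= eqxx.
rewrite big1 => [|i _]; last first.
  rewrite tnth_mktuple /= !eqSS ltn_eqF //.
  by elim: (0 + i)%N => /= [|l ->]; rewrite !mulg_morph1.
rewrite [theta (theta _)]thetak mulg_morphV // thetab.
by rewrite mul1g !mulgA !mulgVK.
Qed.

(** Here [u] is [theta a * .. * theta^(n-2) a * b], the [b] being the left one of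
    [theta^(n-1) y = b * y * b^-1]. *)
Lemma der_retract a : exists u, forall x y, retract f a x y = x * u * y.
Proof.
have [_ thetab thetan fE] := hder.
exists ((\prod_(i < n.-2) iter i.+1 theta a) * b) => x y.
rewrite /retract fE; move: thetan.
case: n n_gt2 => [|[|k]] // _ thetak.
rewrite big_ord_recl big_ord_recr /= !tnth_mktuple /= eqxx.
rewrite [theta (iter _ _ _)]thetak !mulgA mulgVK.
congr (_ * _ * _ * _); apply: eq_bigr => i _.
by rewrite tnth_mktuple /= /bump /= !add1n !eqSS ltn_eqF.
Qed.

(** Terms in the variables [x_i] and [x_i^-1] make an induction possible on a
    term and its inverse at once, with products as the only operation. *)
Lemma group_noetherian_of_polyadic :
  polyadic_equational_noetherian f -> group_equational_noetherian G.
Proof.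
apply: (@noetherian_pullback _ _ _ _ _ _ id) => // m.
pose beta (v : m.-tuple G) := cat_tuple v (map_tuple (fun g => g^-1) v).
pose pdef := definable (@polyadic_eval n G f) beta.
have pdef_mul F1 F2 : pdef F1 -> pdef F2 -> pdef (fun v => F1 v * F2 v).
  move=> [t1 e1] [t2 e2].
  exists (POp (fun k : 'I_n => if k == 0 :> nat then t1
    else if k == n.-1 :> nat then t2
    else PConst _ _ (if k == 1%N :> nat then b^-1 else 1))) => v /=.
  rewrite e1 e2 -der_mul; congr f; apply: eq_from_tnth => k.
  by rewrite !tnth_mktuple; do 2?case: ifP.
exists (m + m)%N, beta => t.
suff [] : pdef (fun v => group_eval v t) /\ pdef (fun v => (group_eval v t)^-1).
  by [].
elim: t => [i|c|t1 [IH1 IH1V] t2 [IH2 IH2V]|t [IH IHV]] /=.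
- split; first by exists (PVar _ _ (lshift m i)) => v; rewrite /= tnth_lshift.
  by exists (PVar _ _ (rshift m i)) => v; rewrite /= tnth_rshift tnth_map.
- by split; [exists (PConst _ _ c) | exists (PConst _ _ c^-1)].
- split; first exact: pdef_mul.
  by under eq_fun do rewrite invgM; exact: pdef_mul.
- by split => //; under eq_fun do rewrite invgK.
Qed.

End Derived.

(** * The equivalence *)

Theorem theorem6p1 (n : nat) (hn : (2 < n)%N) (G : groupType)
    (theta : {multiplicative G -> G}) (b : G) (f : n.-tuple G -> G)
    (hf : is_polyadic_group f) (hder : is_der f theta b)
    (Gs : groupType) (iota : G -> Gs) (hpost : is_post_cover f iota) :
  (polyadic_equational_noetherian f <-> group_equational_noetherian Gs) /\
  (group_equational_noetherian Gs <-> group_equational_noetherian G).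
Proof.
have [iota_inj [R [[R_grp R_nrm] _ [a [h [[hR h_inj h_surj] hM]]]
  [psi [[_ _ psi_surj] _]]]] iotaM _] := hpost.
have [u uE] := der_retract hn hder a.
(* [h] is multiplicative for the product [x * u * y], to which the map
   [x |-> x * u^-1] carries the product of [G]. *)
pose phi x := h (x * u^-1).
have phiM : {morph phi : x y / x * y}.
  by move=> x y; rewrite /phi -hM uE mulgVK mulgA.
have phi_inj : injective phi.
  by move=> x y /h_inj; rewrite !in_setT => /(_ erefl erefl)/mulIg.
have phiR x : R (phi x) by exact: hR.
have Rphi r : R r -> exists x, r = phi x.
  by move=> /h_surj[x _ <-]; exists (x * u); rewrite /phi mulgK.
have R1 : R 1 by have [+ _] := R_grp; rewrite !inE.
have phi_nrm x g : exists y, phi x ^ g = phi y by exact/Rphi/R_nrm.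
have /choice[c cP] : forall j, exists g, range (left_coset R) (psi j) ->
    psi j = left_coset R g.
  move=> j; have [[g _ gE]|] := pselect (range (left_coset R) (psi j)).
    by exists g.
  by exists 1.
have c_cover g : exists j x, g = c j * phi x.
  have [j _ jE] := psi_surj (left_coset R g) (imageT _ _).
  have : left_coset R g g by exists 1 => //; rewrite mulg1.
  rewrite -jE cP; last by rewrite jE; exact: imageT.
  by move=> [r /Rphi[x ->] <-]; exists j, x.
have ii_i : group_equational_noetherian Gs -> polyadic_equational_noetherian f.
  exact: (polyadic_noetherian_of_group (ltnW hn) hf iota_inj iotaM).
have iii_ii : group_equational_noetherian G -> group_equational_noetherian Gs.
  exact: (noetherian_finite_extension phiM phi_inj phi_nrm c_cover).
have i_iii := group_noetherian_of_polyadic hn hder.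
have ii_iii := noetherian_subgroup phiM phi_inj.
by split; split => // /i_iii.
Qed.
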